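(* Let $K, L \subset \mathbb{R}^d$ be convex bodies containing the origin in their interiors with $K \subseteq L$, let $F$ be a linear subspace of $\mathbb{R}^d$, and assume that $K$ is a largest-volume member of $\mathcal{A}_F(K)$ contained in $L$. Suppose in addition that $P_F K\subset L\cap F$. Then there exists a vector $z$ in the relative interior of $P_F K$ such that \[ P_F(K-z)\subset (L-z)\cap F\subset -d\cdot P_F(K-z). \] In particular, such a vector $z$ exists whenever $K$ is symmetric with respect to $F$ (i.e. invariant under the reflection $x\mapsto P_Fx-P_{F^\perp}x$).
   Context: A convex body is a compact convex set with nonempty interior. For a linear subspace $F\subseteq\mathbb{R}^d$, an $F$-operator is an invertible linear operator $A$ on $\mathbb{R}^d$ such that $F$ and $F^\perp$ are invariant subspaces of $A$ and the restriction of $A$ to $F^\perp$ is a nonzero multiple of the identity on $F^\perp$. For $S\subseteq\mathbb{R}^d$, $\mathcal{A}_F(S)=\{AS+z:\ A \text{ an } F\text{-operator},\ z\in\mathbb{R}^d\}$. $P_F$ denotes orthogonal projection onto $F$. *)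

(* Defs.v *)
From HB Require Import structures.
From mathcomp Require Import all_boot all_order all_algebra.
From mathcomp Require Import all_classical all_reals all_analysis.
Set Implicit Arguments. Unset Strict Implicit. Unset Printing Implicit Defensive.
Import Order.TTheory GRing.Theory Num.Theory.
Import numFieldNormedType.Exports.
Local Open Scope classical_set_scope.
Local Open Scope ring_scope.

Section Defs.
Variables (R : realType) (d : nat).
Notation V := 'rV[R]_d.

Definition inner (u v : V) : R := \sum_i u 0 i * v 0 i.

Definition subsp (F : 'M[R]_d) : set V := [set x | (x <= F)%MS].

Definition orth (F : 'M[R]_d) : set V :=
  [set x | forall v, subsp F v -> inner x v = 0].

Definition oproj (W : set V) (x : V) : V :=
  xget 0 [set y | W y /\ forall v, W v -> inner (x - y) v = 0].

Definition PF (F : 'M[R]_d) (x : V) : V := oproj (subsp F) x.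

Definition convex_body (K : set V) : Prop :=
  compact K /\ convex_set (K : set (convex_lmodType V)) /\ interior K !=set0.

Definition F_operator (F : 'M[R]_d) (A : 'M[R]_d) : Prop :=
  A \in unitmx /\
  (forall x, subsp F x -> subsp F (x *m A)) /\
  (forall x, orth F x -> orth F (x *m A)) /\
  (exists c : R, c != 0 /\ forall x, orth F x -> x *m A = c *: x).

Definition A_F (F : 'M[R]_d) (S : set V) : set (set V) :=
  [set M | exists A z, F_operator F A /\ M = [set x *m A + z | x in S]].

(* Volume: Lebesgue (outer) measure on R^d via countable covers by boxes *)
Definition box (a b : V) : set V := [set x | forall i, a 0 i <= x 0 i <= b 0 i].
Definition boxvol (a b : V) : R := \prod_i Num.max 0 (b 0 i - a 0 i).
Definition vol (S : set V) : \bar R :=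
  ereal_inf [set s | exists a b : nat -> V,
     S `<=` \bigcup_k box (a k) (b k) /\
     s = (\sum_(0 <= k <oo) (boxvol (a k) (b k))%:E)%E].

Definition largest_in (F : 'M[R]_d) (K L : set V) : Prop :=
  K `<=` L /\ forall M, A_F F K M -> M `<=` L -> (vol M <= vol K)%E.

Definition affine_set (S : set V) : Prop :=
  forall x y (t : R), S x -> S y -> S ((1 - t) *: x + t *: y).
Definition aff (S : set V) : set V :=
  \bigcap_(T in [set T | affine_set T /\ S `<=` T]) T.

Definition relint (S : set V) : set V :=
  [set x | S x /\ exists e : R, 0 < e /\ ball x e `&` aff S `<=` S].

Definition sym_wrt (F : 'M[R]_d) (K : set V) : Prop :=
  forall x, K x -> K (PF F x - oproj (orth F) x).

Definition good_center (F : 'M[R]_d) (K L : set V) : Prop :=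
  exists z, relint (PF F @` K) z /\
    let PKz := [set PF F (x - z) | x in K] in
    let Lz := [set y - z | y in L] `&` subsp F in
    PKz `<=` Lz /\ Lz `<=` [set (- (d%:R)) *: w | w in PKz].

End Defs.

(* Main.v *)
Require Import Defs.
From HB Require Import structures.
From mathcomp Require Import all_boot all_order all_algebra all_fingroup.
From mathcomp Require Import all_classical all_reals all_analysis.
From mathcomp Require Import measurable_realfun.
From mathcomp Require Import ring lra.
Set Implicit Arguments. Unset Strict Implicit. Unset Printing Implicit Defensive.
Import Order.TTheory GRing.Theory Num.Theory.
Import numFieldNormedType.Exports.
Local Open Scope ring_scope.

(** Let K' be the projection of K on F and L' the section of L by F. It is enough to find w with
    w - y / d in K' for every y in L', since then z := d / (d + 1) w is the required center. By
    compactness, if there is no such w then finitely many of the sets K' + y_i / d have empty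
    intersection. Separating them gives vectors f_i of F with sum zero such that
    - sum_i <f_i, y_i> > d sum_i alpha_i, where alpha_i is the maximum of f_i on K'. After adding
    a small e to the alpha_i and dividing by the sum s of the alpha_i, the affine map
    x |-> sum_i (alpha_i - <f_i, x>) / s y_i sends K into L', and its linear part A maps F to
    itself, vanishes on the orthogonal of F and has trace > d. But K has largest volume, so
    det ((1 - t) I + t A) <= 1 for small t > 0, which forces tr A <= d. *)

(** * Generation of invertible matrices *)

Section ElementaryMatrices.
Context {F : fieldType} {n : nat}.
Implicit Types (A U : 'M[F]_n.+1) (Q : 'M[F]_n.+1 -> Prop).

(* The leftmost nontrivial column is cleared first: the columns to its left are those of
   the identity. *)
Lemma unitriangular_ind Q :
  Q 1%:M ->
  (forall A i j (t : F), i != j -> Q A -> Q (A *m (1%:M + t *: delta_mx i j))) ->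
  forall U, (forall i j : 'I_n.+1, (j <= i)%N -> U i j = (i == j)%:R) -> Q U.
Proof.
move=> Q1 QE U.
pose off U := [set ij : 'I_n.+1 * 'I_n.+1 | (ij.1 < ij.2)%N && (U ij.1 ij.2 != 0)].
move: {2}_.+1 (ltnSn #|off U|) => N; elim: N U => // N IH U leN Utri.
have [off0|[[i0 j0] ij0]] := set_0Vmem (off U).
  rewrite (_ : U = 1%:M)//; apply/matrixP => i j; rewrite mxE.
  have [ji|ij] := leqP j i; first by rewrite Utri.
  have /negbT : (i, j) \in off U = false by rewrite off0 inE.
  by rewrite inE/= ij/= negbK => /eqP ->; rewrite -val_eqE/= ltn_eqF.
case: (@arg_minnP _ (i0, j0) [pred ij in off U] (fun ij => val ij.2) ij0) => -[i j] /=.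
rewrite inE/= => /andP[ij Uij] jmin.
have ij' : i != j by rewrite -val_eqE/= ltn_eqF.
have coli a : U a i = (a == i)%:R.
  have [/Utri//|ai] := leqP i a.
  rewrite -val_eqE/= ltn_eqF//; apply/eqP; apply: contraTT ij => Uai.
  by rewrite -leqNgt; apply: (jmin (a, i)); rewrite inE/= ai.
(* Column [i] of [U] is already that of the identity, so [U *m delta_mx i j = delta_mx i j] and the
   transvection splits off on the right. *)
pose T := U - U i j *: delta_mx i j.
have -> : U = T *m (1%:M + U i j *: delta_mx i j).
  rewrite mulmxDr mulmx1 -scalemxAr {1}/T mulmxBl -scalemxAl mul_delta_mx_0 1?eq_sym//.
  rewrite scaler0 subr0 (_ : U *m _ = delta_mx i j) ?subrK//.
  apply/matrixP => a b; rewrite !mxE (bigD1 i)//= big1 ?addr0; last first.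
    by move=> k ki; rewrite mxE (negPf ki) mulr0.
  by rewrite mxE eqxx/= coli -natrM mulnb.
apply: QE => //; apply: IH.
  rewrite ltnS in leN; apply: leq_trans leN; apply: proper_card; apply/properP; split.
    apply/fintype.subsetP => -[a b]; rewrite !inE !mxE/= => /andP[-> /=].
    case: (a =P i) => [->|_]/=; last by rewrite mulr0 subr0.
    by case: (b =P j) => [->|_]/=; rewrite ?mulr1 ?subrr ?eqxx// mulr0 subr0.
  by exists (i, j); rewrite !inE/= ij ?Uij// !mxE !eqxx mulr1 subrr eqxx.
move=> a b ba; rewrite /T !mxE (Utri _ _ ba) (_ : (_ && _) = false) ?mulr0 ?subr0//.
apply/negbTE/negP => /andP[/eqP ai /eqP bj].
by move: ba; rewrite ai bj leqNgt ij.
Qed.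

(** Follows from the LUP decomposition; it allows the volume bound for linear maps to be checked on
    generators only. *)
Lemma unitmx_ind Q :
  (forall A B, Q A -> Q B -> Q (A *m B)) ->
  (forall s, Q (perm_mx s)) ->
  (forall v : 'rV_n.+1, (forall i, v 0 i != 0) -> Q (diag_mx v)) ->
  (forall i j (t : F), i != j -> Q (1%:M + t *: delta_mx i j)) ->
  forall A, A \in unitmx -> Q A.
Proof.
move=> QM Qperm Qdiag QE A Aunit.
have Q1 : Q 1%:M by rewrite -perm_mx1.
have Qupper U : (forall i j : 'I_n.+1, (j <= i)%N -> U i j = (i == j)%:R) -> Q U.
  by apply: unitriangular_ind => // B i j t ij QB; apply: QM => //; exact: QE.
have Qlower U : (forall i j : 'I_n.+1, (i <= j)%N -> U i j = (i == j)%:R) -> Q U.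
  move=> Ulow; rewrite -[U]trmxK.
  apply: (@unitriangular_ind (fun B => Q B^T)); first by rewrite trmx1.
    move=> B i j t ij QB; rewrite trmx_mul; apply: QM => //.
    by rewrite linearD linearZ/= trmx1 trmx_delta; apply: QE; rewrite eq_sym.
  by move=> i j ij; rewrite mxE Ulow// eq_sym.
have := cormen_lup_correct A; have := cormen_lup_perm A.
have := @cormen_lup_lower _ _ A; have := @cormen_lup_upper _ _ A.
have := cormen_lup_detL A.
case: (cormen_lup A) => [[P L] U]/= detL Uup Llow /is_perm_mxP[s ->] PA.
(* The product of the diagonal entries of [U] is the determinant of [A] up to sign. *)
have Udiag i : U i i != 0.
  have : \det U^T != 0.
    have detPA : \det (perm_mx s) * \det A = \det U.
      by rewrite -det_mulmx [_ *m A]PA [LHS]det_mulmx detL mul1r.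
    rewrite det_tr -detPA det_perm mulf_neq0 ?signr_eq0//.
    by rewrite -unitfE -unitmxE.
  rewrite det_trig; last by apply/is_trig_mxP => a b ab; rewrite mxE Uup.
  by move/prodf_neq0 => /(_ i isT); rewrite mxE.
have {PA} -> : A = perm_mx s^-1 *m (L *m U).
  by rewrite -[L *m U]PA mulmxA -perm_mxM mulVg perm_mx1 mul1mx.
apply: (QM) => //; apply: (QM); first exact: Qlower.
(* Dividing each column by its pivot leaves a factor with unit diagonal. *)
have -> : U = (\matrix_(i, j) (U i j / U j j)) *m diag_mx (\row_i U i i).
  by rewrite mul_mx_diag; apply/matrixP => i j; rewrite !mxE divfK.
apply: QM; last by apply: Qdiag => i; rewrite mxE.
apply: Qupper => i j; rewrite leq_eqVlt => /predU1P[/val_inj <-|ji].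
  by rewrite mxE eqxx divff.
by rewrite mxE Uup// mul0r -val_eqE/= gtn_eqF.
Qed.

End ElementaryMatrices.

Local Open Scope classical_set_scope.

(** * Volume *)

Section Volume.
Context {R : realType}.

Section AnyDimension.
Context {d : nat}.
Notation V := 'rV[R]_d.
Implicit Types (S T : set V) (a b : V).

Lemma boxvol_ge0 a b : 0 <= boxvol a b.
Proof. by apply: prodr_ge0 => i _; rewrite le_max lexx. Qed.

Lemma vol_ge0 S : (0 <= vol S)%E.
Proof.
apply: le_ereal_inf_tmp => _ [a [b [_ ->]]].
by apply: nneseries_ge0 => k _ _; rewrite lee_fin boxvol_ge0.
Qed.

Lemma le_vol S T : S `<=` T -> (vol S <= vol T)%E.
Proof.
move=> ST; apply/ereal_inf_le_tmp => _ [a [b [Tab ->]]].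
by exists a, b; split => //; exact: subset_trans Tab.
Qed.

(** Covers of the [S n] with excess [e / 2 ^ n.+1] are merged into a single cover through a
    bijection between [nat] and pairs. *)
Lemma vol_sigma_subadditive (S : nat -> set V) :
  (vol (\bigcup_n S n) <= \sum_(0 <= n <oo) vol (S n))%E.
Proof.
have [[i ioo]|] := pselect (exists i, vol (S i) = +oo%E).
  rewrite (eseries_pinfty _ _ ioo) ?leey// => n _.
  by rewrite -ltNye (lt_le_trans _ (vol_ge0 _)).
rewrite -forallNE => Soo.
apply/lee_addgt0Pr => e e0.
rewrite (le_trans _ (epsilon_trick _ _ (ltW e0)))//; last first.
  by move=> n; exact: vol_ge0.
pose P n (B : nat -> V * V) := S n `<=` \bigcup_k box (B k).1 (B k).2 /\
  (\sum_(0 <= k <oo) (boxvol (B k).1 (B k).2)%:E <=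
    vol (S n) + (e / (2 ^ n.+1)%:R)%:E)%E.
have [G PG] : {G : nat -> nat -> V * V & forall n, P n (G n)}.
  apply: (@choice _ _ P) => n; rewrite /P.
  have Sfin : vol (S n) \is a fin_num.
    by rewrite ge0_fin_numE ?vol_ge0// ltey; apply/eqP/Soo.
  have en : 0 < e / (2 ^ n.+1)%:R.
    by rewrite divr_gt0// ltr0n expn_gt0.
  have [_ [a [b [Sab ->]]] /ltW ab] := lb_ereal_inf_adherent en Sfin.
  by exists (fun k => (a k, b k)).
pose m (B : V * V) : \bar R := (boxvol B.1 B.2)%:E.
have m_ge0 x : (0 <= (m \o uncurry G) x)%E by rewrite lee_fin boxvol_ge0.
apply: (@le_trans _ _ (\esum_(i in setT) (m \o uncurry G) i)).
  apply: ereal_inf_lbound => /=.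
  have /card_esym/ppcard_eqP[f] := card_nat2.
  exists (fst \o (uncurry G \o f)), (snd \o (uncurry G \o f)); split.
    move=> t [i _ /(PG i).1 [j _ Bijt]]; exists (f^-1%FUN (i, j)) => //=.
    by rewrite invK ?inE.
  have := esum_pred_image (m \o uncurry G) f xpredT.
  rewrite /= [fun=> _]set_true image_eq => -> // k _; exact: m_ge0.
rewrite (_ : esum _ _ = \sum_(0 <= i <oo) \sum_(0 <= j <oo) m (G i j))%E; last first.
  pose J : nat -> set (nat * nat) := fun i => [set (i, j) | j in setT].
  rewrite (_ : setT = \bigcup_k J k); last first.
    by rewrite predeqE => -[a b]; split => // _; exists a => //; exists b.
  rewrite esum_bigcupT /=; last 2 first.
    - apply/trivIsetP => i j _ _ ij.
      rewrite predeqE => -[n p] /=; split => //= -[] [_] _ [<-{n} _].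
      by move=> [m' _] [] /esym/eqP; rewrite (negbTE ij).
    - by move=> x; exact: m_ge0.
  rewrite -(image_id [set: nat]) -fun_true esum_pred_image//; last first.
    by move=> n _; apply: esum_ge0 => x _; exact: m_ge0.
  apply: eq_eseriesr => /= j _.
  rewrite -(esum_pred_image (m \o uncurry G) (pair j) predT); last 2 first.
    - by move=> k _; exact: (m_ge0 (j, k)).
    - by move=> ? ? _ _; exact: (@can_inj _ _ _ snd).
  by congr esum; rewrite predeqE => -[a b]; split; move=> [i _ <-]; exists i.
apply: lee_nneseries => [i _ _|i _]; last exact: (PG i).2.
by apply: nneseries_ge0 => j _ _; exact: (m_ge0 (i, j)).
Qed.

(** The images of the boxes covering [S] cover the image of [S], so subadditivity carries the bound
    from boxes to all sets. *)
Lemma vol_image_le (f : V -> V) (c : R) : 0 < c ->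
  (forall a b, (vol (f @` box a b) <= (c * boxvol a b)%:E)%E) ->
  forall S, (vol (f @` S) <= c%:E * vol S)%E.
Proof.
move=> c0 fc S.
rewrite -lee_pdivrMl//; apply: le_ereal_inf_tmp => _ [a [b [Sab ->]]].
rewrite lee_pdivrMl// -nneseriesZl//; last first.
  by move=> k _; rewrite lee_fin boxvol_ge0.
have fS : f @` S `<=` \bigcup_k (f @` box (a k) (b k)).
  by move=> _ [x /Sab[k _ xk] <-]; exists k => //; exists x.
apply: (le_trans (le_vol fS)); apply: (le_trans (vol_sigma_subadditive _)).
apply: lee_nneseries => [k _ _|k _]; first exact: vol_ge0.
by rewrite -EFinM.
Qed.

End AnyDimension.

Section PositiveDimension.
Context {n : nat}.
Notation V := 'rV[R]_n.+1.
Implicit Types (S T : set V) (a b : V).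

(** This fails in dimension 0, where every box has volume 1 as an empty product; hence the successor
    dimension. *)
Lemma boxvol_degenerate a : boxvol a a = 0.
Proof. by rewrite /boxvol (bigD1 ord0)//= subrr maxxx mul0r. Qed.

(** Since [vol] asks for infinite covers, the boxes from index [N] on are degenerate ones at the
    origin. *)
Lemma vol_finite_cover S (N : nat) (a b : nat -> V) :
  S `<=` \bigcup_(k < N) box (a k) (b k) ->
  (vol S <= (\sum_(k < N) boxvol (a k) (b k))%:E)%E.
Proof.
move=> Sab; apply: ereal_inf_lbound.
exists (fun k => if (k < N)%N then a k else 0), (fun k => if (k < N)%N then b k else 0).
split.
  by move=> x /Sab[k /= kN xk]; exists k => //; rewrite kN.
rewrite (nneseries_split 0 N)//; last first.
  by move=> k _; rewrite lee_fin boxvol_ge0.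
rewrite add0n eseries0 ?adde0; last first.
  by move=> k Nk _; rewrite ltnNge Nk/= boxvol_degenerate.
rewrite big_mkord sumEFin; congr EFin; apply: eq_bigr => k _.
by rewrite ltn_ord.
Qed.

Lemma vol_box_le a b : (vol (box a b) <= (boxvol a b)%:E)%E.
Proof.
apply: (le_trans (@vol_finite_cover _ 1 (fun=> a) (fun=> b) _)).
  by move=> x xab; exists 0%N.
by rewrite big_ord1.
Qed.

End PositiveDimension.
End Volume.

(** * Volume under invertible linear maps *)

Section VolumeLinear.
Context {R : realType} {n : nat}.
Notation V := 'rV[R]_n.+1.
Implicit Types (S T : set V) (a b : V).

Lemma box_eq0 a b i : b 0 i < a 0 i -> box a b = set0.
Proof.
move=> ba; rewrite -subset0 => x /(_ i) /andP[ax xb].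
by move: ba; rewrite ltNge (le_trans ax xb).
Qed.

Lemma vol0 : vol (set0 : set V) = 0%E.
Proof.
apply/eqP; rewrite eq_le vol_ge0 andbT.
have /le_vol : (set0 : set V) `<=` box 0 0 by [].
by move/le_trans; apply; apply: (le_trans (vol_box_le _ _)); rewrite boxvol_degenerate.
Qed.

Lemma vol_image_box_le (f : V -> V) (c : R) : 0 < c ->
  (forall a b, (forall i, a 0 i <= b 0 i) ->
     (vol (f @` box a b) <= (c * \prod_i (b 0 i - a 0 i))%:E)%E) ->
  forall S, (vol (f @` S) <= c%:E * vol S)%E.
Proof.
move=> c0 fc; apply: vol_image_le => // a b.
have [[i ba]|/forallNP ab] := pselect (exists i, b 0 i < a 0 i).
  by rewrite (box_eq0 ba) image_set0 vol0 lee_fin mulr_ge0 ?boxvol_ge0// ltW.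
have {}ab i : a 0 i <= b 0 i by rewrite leNgt; apply/negP/ab.
apply: (le_trans (fc _ _ ab)); rewrite lee_fin (ler_wpM2l (ltW c0))//.
by rewrite /boxvol; apply: ler_prod => i _; rewrite subr_ge0 ab le_max lexx orbT.
Qed.

Lemma vol_translate_le S z : (vol [set (x + z)%R | x in S] <= vol S)%E.
Proof.
rewrite -[leRHS]mul1e; apply: vol_image_box_le => // a b ab.
apply: (@le_trans _ _ (vol (box (a + z) (b + z)))).
  by apply: le_vol => _ [x xab <-] i; rewrite !mxE !lerD2r xab.
apply: (le_trans (vol_box_le _ _)); rewrite lee_fin mul1r /boxvol.
apply: ler_prod => i _; rewrite le_max lexx/= !mxE.
by rewrite opprD addrACA subrr addr0 max_r// subr_ge0.
Qed.

Lemma vol_perm_mx_le (s : {perm 'I_n.+1}) S :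
  (vol [set x *m perm_mx s | x in S] <= vol S)%E.
Proof.
rewrite -[leRHS]mul1e; apply: vol_image_box_le => // a b ab.
have sE (x : V) i : (x *m perm_mx s) 0 i = x 0 (s^-1%g i).
  by rewrite -[s]invgK -col_permE mxE invgK.
apply: (@le_trans _ _ (vol (box (a *m perm_mx s) (b *m perm_mx s)))).
  by apply: le_vol => _ [x xab <-] i; rewrite !sE.
apply: (le_trans (vol_box_le _ _)); rewrite lee_fin mul1r /boxvol.
rewrite [leRHS](reindex_inj (@perm_inj _ s^-1%g)).
apply: ler_prod => i _; rewrite le_max lexx/= !sE.
by rewrite max_r// subr_ge0.
Qed.

Lemma vol_diag_mx_le (v : V) S : (forall i, v 0 i != 0) ->
  (vol [set x *m diag_mx v | x in S] <= `|\det (diag_mx v)|%:E * vol S)%E.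
Proof.
move=> v0.
have detv : 0 < `|\det (diag_mx v)|.
  by rewrite normr_gt0 det_diag; apply/prodf_neq0.
apply: vol_image_box_le => // a b ab.
(* A negative factor reverses an interval: [lo a b] is the lower corner of the image and [lo b a]
   the upper one. *)
pose lo (a b : V) := \row_i (if 0 <= v 0 i then a 0 i * v 0 i else b 0 i * v 0 i) : V.
apply: (@le_trans _ _ (vol (box (lo a b) (lo b a)))).
  apply: le_vol => _ [x xab <-] i; rewrite mul_mx_diag !mxE.
  have /andP[ax xb] := xab i.
  have [vi|vi] := leP 0 (v 0 i); first by rewrite !ler_wpM2r.
  by rewrite !ler_wnM2r// ltW.
apply: (le_trans (vol_box_le _ _)); rewrite lee_fin det_diag normr_prod -big_split/=.
apply: ler_prod => i _; rewrite le_max lexx/= !mxE ge_max.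
rewrite mulr_ge0 ?subr_ge0//=.
by have [vi|vi] := leP 0 (v 0 i); [rewrite ger0_norm// | rewrite ltr0_norm//]; lra.
Qed.

(* A box is cut into N + 1 slabs across direction i; sheared, each slab fits in a box whose
   extra volume is of order 1 / N ^ 2. *)
Lemma vol_shear_le (i j : 'I_n.+1) (t : R) S : i != j ->
  (vol [set x *m (1%:M + t *: delta_mx i j) | x in S] <= vol S)%E.
Proof.
move=> ij; rewrite -[leRHS]mul1e; apply: vol_image_box_le => // a b ab; rewrite mul1r.
have shE (x : V) k : (x *m (1%:M + t *: delta_mx i j)) 0 k = x 0 k + t * x 0 i * (k == j)%:R.
  rewrite mulmxDr mulmx1 !mxE; congr (_ + _); rewrite (bigD1 i)//= big1 ?addr0.
    by rewrite !mxE eqxx/= mulrCA mulrA.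
  by move=> l li; rewrite !mxE (negPf li) mulr0 mulr0.
pose P := \prod_(k < n.+1 | (k != i) && (k != j)) (b 0 k - a 0 k).
have P0 : 0 <= P by apply: prodr_ge0 => k _; rewrite subr_ge0.
have prodE (f : 'I_n.+1 -> R) :
    \prod_k f k = f i * (f j * \prod_(k < n.+1 | (k != i) && (k != j)) f k).
  by rewrite (bigD1 i)//= (bigD1 j)//= eq_sym.
pose w := b 0 i - a 0 i.
have w0 : 0 <= w by rewrite subr_ge0.
pose C := P * w * (2 * `|t| * w).
have C0 : 0 <= C by rewrite !mulr_ge0.
(* The term [C / N.+1%:R] is the total extra volume of the [N.+1] widened slabs. *)
suff main N : (vol [set x *m (1%:M + t *: delta_mx i j) | x in box a b] <=
    (\prod_k (b 0 k - a 0 k) + C / N.+1%:R)%:E)%E.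
  apply/lee_addgt0Pr => e e0.
  have [N Ne] : exists N : nat, C / N.+1%:R <= e.
    exists (Num.truncn (C / e)); rewrite ler_pdivrMr ?ltr0n// mulrC -ler_pdivrMr//.
    by rewrite ltW// truncnS_gt.
  by apply: (le_trans (main N)); rewrite -EFinD lee_fin lerD2l.
pose h := w / N.+1%:R.
have h0 : 0 <= h by rewrite divr_ge0.
pose c k := a 0 i + k%:R * h.
(* On slab [k] the displacement [t * x 0 i] of coordinate [j] is within [|t| * h] of [t * c k], so
   the side [j] is widened by that much at both ends. *)
pose lo k : V := \row_l (if l == i then c k else
  if l == j then a 0 j + t * c k - `|t| * h else a 0 l).
pose hi k : V := \row_l (if l == i then c k + h else
  if l == j then b 0 j + t * c k + `|t| * h else b 0 l).
apply: (le_trans (@vol_finite_cover _ _ _ N.+1 lo hi _)).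
  move=> _ [x xab <-].
  (* The index is the integer part of [(x 0 i - a 0 i) / h], replaced by [N] when it exceeds [N]; a
     flat box, with [h = 0], is treated apart. *)
  have [k kN /andP[ck kc]] : exists2 k, (k < N.+1)%N & c k <= x 0 i <= c k + h.
    have /andP[ax xb] := xab i.
    have [w00|wn0] := eqVneq w 0.
      exists 0%N => //; rewrite /c /h w00 !mul0r !addr0.
      by apply/andP; split => //; move: w00; rewrite /w; lra.
    have h1 : 0 < h by rewrite divr_gt0 ?ltr0n// lt_neqAle eq_sym wn0.
    have xh : 0 <= (x 0 i - a 0 i) / h by rewrite divr_ge0 ?subr_ge0// ltW.
    have /andP[kx xk] := truncn_itv xh.
    move: kx xk; rewrite ler_pdivlMr// ltr_pdivrMr// => kx xk.
    have [kN|Nk] := ltnP (Num.truncn ((x 0 i - a 0 i) / h)) N.+1.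
      exists (Num.truncn ((x 0 i - a 0 i) / h)) => //.
      move: xk; rewrite -natr1 /c mulrDl mul1r => xk.
      by apply/andP; split; [move: kx|move: xk]; lra.
    exists N => //.
    have Nh : N.+1%:R * h = w by rewrite /h mulrC divfK// pnatr_eq0.
    have Nh' : N.+1%:R * h <= (Num.truncn ((x 0 i - a 0 i) / h))%:R * h.
      by rewrite ler_wpM2r// ler_nat.
    move: Nh Nh'; rewrite -natr1 mulrDl mul1r /c /w => Nh Nh'.
    by apply/andP; split; lra.
  exists k => // l; rewrite shE !mxE.
  have [->|li] := eqVneq l i.
    by rewrite (negPf ij) mulr0 addr0 ck.
  have [->|lj] := eqVneq l j; last by rewrite mulr0 addr0 xab.
  have /andP[ax xb] := xab j.
  have : `|t * (x 0 i - c k)| <= `|t| * h.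
    rewrite normrM ler_wpM2l// ger0_norm ?subr_ge0//.
    by rewrite lerBlDl.
  rewrite ler_norml => /andP[]; rewrite mulrBr mulr1 => t1 t2.
  by apply/andP; split; lra.
rewrite lee_fin [leLHS](eq_bigr (fun=> h * ((b 0 j - a 0 j + 2 * `|t| * h) * P))); last first.
  move=> k _; rewrite /boxvol prodE !mxE !eqxx (eq_sym j i) (negPf ij).
  congr (_ * (_ * _)).
  - by rewrite max_r; lra.
  - have := ab j; have : 0 <= `|t| * h by rewrite mulr_ge0.
    by move=> ? ?; rewrite max_r; lra.
  - by apply: eq_bigr => l /andP[/negPf li /negPf lj]; rewrite !mxE li lj max_r// subr_ge0.
rewrite sumr_const card_ord prodE -/w -/P.
rewrite le_eqVlt; apply/orP; left; apply/eqP.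
rewrite -[LHS]mulr_natr /C /h.
have : N.+1%:R != 0 :> R by rewrite pnatr_eq0.
by move: (N.+1%:R) => m m0; field.
Qed.

(** The bound passes to products, so the generators of [unitmx_ind] suffice. A lower bound for the
    image comes from applying this to the inverse matrix. *)
Lemma vol_mulmx_le (A : 'M[R]_n.+1) S : A \in unitmx ->
  (vol [set x *m A | x in S] <= `|\det A|%:E * vol S)%E.
Proof.
move=> Aunit; move: A Aunit S; apply: unitmx_ind => [A B QA QB S|s S|v v0 S|i j t ij S].
- rewrite (_ : [set _ | _ in S] = [set y *m B | y in [set x *m A | x in S]]).
    apply: (le_trans (QB _)); rewrite det_mulmx normrM mulrC EFinM -muleA.
    exact: lee_wpmul2l.
  rewrite image_comp; apply: eq_imagel => x _ /=; exact: mulmxA.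
- by rewrite det_perm normr_sign mul1e vol_perm_mx_le.
- exact: vol_diag_mx_le.
- rewrite (_ : \det _ = 1) ?normr1 ?mul1e ?vol_shear_le//.
  have trig1 (k l : 'I_n.+1) : (k < l)%N -> is_trig_mx (1%:M + t *: delta_mx l k : 'M[R]_n.+1).
    move=> kl; apply/is_trig_mxP => a b ab; rewrite !mxE -val_eqE/= (ltn_eqF ab).
    case: eqP => [al|]; last by rewrite mulr0 addr0.
    case: eqP => [bk|]; last by rewrite mulr0 addr0.
    by move: ab; rewrite al bk ltnNge ltnW.
  have diag1 (k l : 'I_n.+1) : k != l -> \prod_i (1%:M + t *: delta_mx k l : 'M[R]_n.+1) i i = 1.
    move=> kl; rewrite big1// => p _; rewrite !mxE eqxx.
    have [->|] := eqVneq p k; last by rewrite mulr0 addr0.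
    by rewrite (negPf kl) mulr0 addr0.
  have [lt_ij|lt_ji|/val_inj ij'] := ltngtP i j; last by rewrite ij' eqxx in ij.
  - rewrite -det_tr linearD linearZ/= trmx1 trmx_delta det_trig ?trig1//.
    by rewrite diag1// eq_sym.
  - by rewrite det_trig ?trig1// diag1.
Qed.
End VolumeLinear.

(** * Lower bound for the volume of a cube *)

Section VolumePositive.
Context {R : realType}.

(* Integrates out one coordinate at a time; the weights w record the coordinates already
   integrated. *)
Lemma weighted_cover_volume (r : R) (a b : nat -> nat -> R) n (w : nat -> R) (c : R) :
  0 < r -> (forall k, 0 <= w k) -> 0 <= c ->
  (forall x : nat -> R, (forall i, (i < n)%N -> - r <= x i <= r) ->
    (c%:E <= \sum_(0 <= k <oo)
       (w k * \prod_(i < n) \1_(`[a k i, b k i] : set R) (x i))%:E)%E) ->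
  ((c * (2 * r) ^+ n)%:E <=
     \sum_(0 <= k <oo) (w k * \prod_(i < n) Num.max 0 (b k i - a k i))%:E)%E.
Proof.
move=> r0; elim: n w c => [|n IH] w c w0 c0 cov.
  have := cov (fun=> 0) (fun i (i0 : (i < 0)%N) => ltac:(by [])).
  rewrite expr0 mulr1 => /le_trans; apply; apply: lee_nneseries => [k _ _|k _].
    by rewrite big_ord0 lee_fin mulr1.
  by rewrite !big_ord0.
pose w' k := w k * Num.max 0 (b k n - a k n).
have w'0 k : 0 <= w' k by rewrite mulr_ge0// le_max lexx.
have c'0 : 0 <= c * (2 * r) by rewrite !mulr_ge0// ltW.
have -> : c * (2 * r) ^+ n.+1 = c * (2 * r) * (2 * r) ^+ n by rewrite exprS mulrA.
rewrite (eq_eseriesr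
  (g := fun k => (w' k * \prod_(i < n) Num.max 0 (b k i - a k i))%:E)); last first.
  by move=> k _; rewrite big_ord_recr/= /w' -!mulrA [X in _ * X]mulrC.
apply: IH => // x xr.
(* With the first [n] coordinates fixed at [x], the pointwise bound is integrated over the last one,
   [t] in [[- r, r]]. *)
pose u k := w k * \prod_(i < n) \1_(`[a k i, b k i] : set R) (x i).
have u0 k : 0 <= u k by rewrite mulr_ge0// prodr_ge0.
pose D := `[- r, r]%classic : set R.
have mD : measurable D by exact: measurable_itv.
have covt t : D t -> (c%:E <= \sum_(0 <= k <oo) (u k)%:E * (\1_(`[a k n, b k n] : set R) t)%:E)%E.
  rewrite /D /= in_itv/= => tr.
  have := cov (fun i => if i == n then t else x i).
  move=> /(_ _)/le_trans; apply => [i|].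
    by rewrite ltnS leq_eqVlt; case: eqP => //= _; exact: xr.
  apply: lee_nneseries => [k _ _|k _]; first by rewrite lee_fin mulr_ge0// prodr_ge0.
  rewrite -EFinM lee_fin big_ord_recr/= eqxx /u -mulrA.
  rewrite le_eqVlt; apply/orP; left; apply/eqP; congr (_ * (_ * _)).
  by apply: eq_bigr => i _; rewrite ltn_eqF.
pose g k (t : R) : \bar R := ((u k)%:E * (\1_(`[a k n, b k n] : set R) t)%:E)%E.
have mI k : measurable_fun D (EFin \o (\1_(`[a k n, b k n] : set R) : R -> R)).
  by apply/measurable_EFinP; apply: measurable_indic; exact: measurable_itv.
have mg k : measurable_fun D (g k).
  by apply: emeasurable_funM; [exact: measurable_cst|exact: mI].
have g0 k t : (0 <= g k t)%E by rewrite mule_ge0 ?lee_fin.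
have mS : measurable_fun D (fun t => \sum_(0 <= k <oo) g k t)%E.
  by apply: (ge0_emeasurable_sum (P := xpredT)) => // k t _ _; exact: g0.
have muD : lebesgue_measure D = (2 * r)%:E.
  rewrite /D lebesgue_measure_itv/= lte_fin ifT; first by rewrite -EFinB; congr EFin; lra.
  lra.
have := @ge0_le_integral _ _ _ lebesgue_measure D mD (cst c%:E)
  (fun t => \sum_(0 <= k <oo) g k t)%E.
have -> : (\int[lebesgue_measure]_(t in D) cst c%:E t = (c * (2 * r))%:E)%E.
  by rewrite integral_cst// EFinM; congr (_ * _)%E; exact: muD.
rewrite integral_nneseries// => /(_ _ _ mS covt)/le_trans; apply.
- by move=> t _; rewrite lee_fin.
- exact: measurable_cst.
apply: lee_nneseries => [k _ _|k _]; first exact: integral_ge0.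
rewrite /g ge0_integralZl_EFin//; last exact: mI.
rewrite integral_indic//.
rewrite (_ : (w' k * _)%:E = ((u k)%:E * (Num.max 0 (b k n - a k n))%:E)%E); last first.
  by rewrite -EFinM /w' /u; congr EFin; ring.
apply: lee_wpmul2l; first by rewrite lee_fin.
apply: (@le_trans _ _ (lebesgue_measure (`[a k n, b k n]%classic : set R))).
  by apply: le_measure; rewrite ?inE//; exact: measurableI.
rewrite lebesgue_measure_itv/= lte_fin; case: ltP => ab.
  by rewrite -EFinB lee_fin le_max lexx orbT.
by rewrite lee_fin le_max lexx.
Qed.

(** For any cover the indicators of the boxes sum to at least 1 on the cube, which feeds
    [weighted_cover_volume] with unit weights. *)
Lemma vol_cube_ge n (r : R) (S : set 'rV[R]_n) : 0 < r ->
  box (const_mx (- r)) (const_mx r) `<=` S -> (((2 * r) ^+ n)%:E <= vol S)%E.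
Proof.
case: n S => [|n] S r0 rS.
  (* In dimension 0 a single box already has volume 1, the empty product. *)
  apply: le_ereal_inf_tmp => _ [a [b [Sab ->]]].
  have [k _ _] : (\bigcup_k box (a k) (b k)) 0 by apply/Sab/rS; case.
  apply: le_trans (nneseries_lim_ge k.+1 _); last by move=> *; rewrite lee_fin boxvol_ge0.
  rewrite big_nat_recr//= -[leLHS]add0e leeD//.
    by rewrite sume_ge0// => *; rewrite lee_fin boxvol_ge0.
  by rewrite lee_fin /boxvol big_ord0.
apply: le_ereal_inf_tmp => _ [a [b [Sab ->]]].
have := @weighted_cover_volume r (fun k i => a k 0 (inord i))
  (fun k i => b k 0 (inord i)) n.+1 (cst 1) 1 r0.
rewrite mul1r => /(_ _ _ _)/le_trans; apply => [//|//|x xr|]; last first.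
  rewrite le_eqVlt; apply/orP; left; apply/eqP; apply: eq_eseriesr => k _.
  by rewrite mul1r; congr EFin; apply: eq_bigr => i _; rewrite inord_val.
pose y : 'rV[R]_n.+1 := \row_i x i.
have [k _ yk] : (\bigcup_k box (a k) (b k)) y.
  by apply/Sab/rS => i; rewrite !mxE; exact: xr.
have pos m : (0 <= (cst 1 m *
    \prod_(i < n.+1) \1_(`[a m 0 (inord i), b m 0 (inord i)] : set R) (x i))%:E)%E.
  by rewrite lee_fin mul1r prodr_ge0.
apply: le_trans (nneseries_lim_ge k.+1 _); last by move=> *; exact: pos.
rewrite big_nat_recr//= -[leLHS]add0e leeD//; first by apply: sume_ge0 => m _; exact: pos.
rewrite lee_fin mul1r big1// => i _; rewrite indicE mem_set//= in_itv/= inord_val.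
by have := yk i; rewrite !mxE.
Qed.
End VolumePositive.

(** * Orthogonal projection and determinants *)

Section InnerProduct.
Context {R : realType} {d : nat}.
Notation V := 'rV[R]_d.
Implicit Types (x y u v : V) (F : 'M[R]_d).

Lemma innerE u v : inner u v = (u *m v^T) 0 0.
Proof. by rewrite mxE; apply: eq_bigr => i _; rewrite mxE. Qed.

Lemma innerC u v : inner u v = inner v u.
Proof. by apply: eq_bigr => i _; rewrite mulrC. Qed.

Lemma innerDl u v y : inner (u + v) y = inner u y + inner v y.
Proof. by rewrite !innerE mulmxDl mxE. Qed.

Lemma innerZl (a : R) u y : inner (a *: u) y = a * inner u y.
Proof. by rewrite !innerE -scalemxAl mxE. Qed.

Lemma innerNl u y : inner (- u) y = - inner u y.
Proof. by rewrite !innerE mulNmx mxE. Qed.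

Lemma inner0l y : inner 0 y = 0.
Proof. by rewrite innerE mul0mx mxE. Qed.

Lemma innerDr u v y : inner y (u + v) = inner y u + inner y v.
Proof. by rewrite innerC innerDl !(innerC y). Qed.

Lemma innerZr (a : R) u y : inner y (a *: u) = a * inner y u.
Proof. by rewrite innerC innerZl (innerC y). Qed.

Lemma innerNr u y : inner y (- u) = - inner y u.
Proof. by rewrite innerC innerNl (innerC y). Qed.

Lemma inner_suml (I : Type) (r : seq I) (f : I -> V) y :
  inner (\sum_(i <- r) f i) y = \sum_(i <- r) inner (f i) y.
Proof.
by elim/big_rec2: _ => [|i a b _ <-]; rewrite ?inner0l ?innerDl.
Qed.

Lemma inner_ge0 u : 0 <= inner u u.
Proof. by apply: sumr_ge0 => i _; rewrite -expr2 sqr_ge0. Qed.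

Lemma inner_eq0 u : inner u u = 0 -> u = 0.
Proof.
move=> /eqP; rewrite psumr_eq0; last by move=> i _; rewrite -expr2 sqr_ge0.
move=> /allP u0; apply/rowP => i; rewrite mxE; apply/eqP.
by have := u0 i (mem_index_enum i); rewrite mulf_eq0 orbb.
Qed.

Lemma subsp_scale F (a : R) x : subsp F x -> subsp F (a *: x).
Proof. exact: scalemx_sub. Qed.

Lemma subsp_add F x y : subsp F x -> subsp F y -> subsp F (x + y).
Proof. exact: addmx_sub. Qed.

Lemma subsp_opp F x : subsp F x -> subsp F (- x).
Proof. by rewrite /subsp/= eqmx_opp. Qed.

(** As [oproj] is a choice by [xget], computing it needs uniqueness: the difference of two
    candidates lies in [W] and is orthogonal to [W], hence to itself. *)
Lemma oproj_unique (W : set V) x y :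
  (forall u v, W u -> W v -> W (u - v)) ->
  W y -> (forall v, W v -> inner (x - y) v = 0) -> oproj W x = y.
Proof.
move=> WB Wy yx; apply/esym; rewrite /oproj.
have := @xgetPex _ 0 [set y | W y /\ forall v, W v -> inner (x - y) v = 0].
move=> /(_ (ex_intro _ y (conj Wy yx)))[]; set y' := xget _ _ => Wy' y'x.
apply/subr0_eq/inner_eq0; have Wyy' := WB _ _ Wy Wy'.
rewrite -{1}[y - y'](subrKA x) innerDl -opprB innerNl yx// oppr0 add0r.
exact: y'x.
Qed.

(** The least-squares formula for orthogonal projection in the basis [row_base F]; a matrix makes
    linearity and continuity of [PF] immediate. *)
Definition proj_mx F : 'M[R]_d :=
  (row_base F)^T *m invmx (row_base F *m (row_base F)^T) *m row_base F.

Lemma proj_mx_sub F x : subsp F (x *m proj_mx F).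
Proof. by rewrite /subsp/= mulmxA (submx_trans (submxMl _ _))// eq_row_base. Qed.

Lemma proj_mx_orth F x v : subsp F v -> inner (x - x *m proj_mx F) v = 0.
Proof.
rewrite /subsp/= => vF.
have /submxP[w ->] : (v <= row_base F)%MS by rewrite eq_row_base.
(* If [y] kills the Gram matrix, then [y *m row_base F] has norm zero and independence of the basis
   gives [y = 0]. *)
have gram_unit : row_base F *m (row_base F)^T \in unitmx.
  rewrite -row_free_unit; apply: inj_row_free => y yG.
  have yB : y *m row_base F = 0.
    by apply: inner_eq0; rewrite innerE trmx_mul mulmxA -[y *m _ *m _]mulmxA yG mul0mx mxE.
  exact: (row_free_inj (row_base_free F)) (etrans yB (esym (mul0mx _ _))).
have projB : (x - x *m proj_mx F) *m (row_base F)^T = 0.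
  rewrite /proj_mx; move: (row_base F) gram_unit => B gram_unit.
  by rewrite mulmxBl -!mulmxA mulVmx// mulmx1 subrr.
by rewrite innerE trmx_mul mulmxA projB mul0mx mxE.
Qed.

Lemma PFE F x : PF F x = x *m proj_mx F.
Proof.
apply: oproj_unique; [|exact: proj_mx_sub|exact: proj_mx_orth].
by move=> u v Fu Fv; apply: subsp_add => //; exact: subsp_opp.
Qed.

Lemma PF_sub F x : subsp F (PF F x).
Proof. by rewrite PFE; exact: proj_mx_sub. Qed.

Lemma inner_PF F x v : subsp F v -> inner (PF F x) v = inner x v.
Proof.
move=> Fv; apply/esym/eqP; rewrite -subr_eq0 -innerNl -innerDl PFE.
by rewrite proj_mx_orth.
Qed.

Lemma PF_id F x : subsp F x -> PF F x = x.
Proof.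
move=> Fx; apply: oproj_unique => //.
  by move=> u v Fu Fv; apply: subsp_add => //; exact: subsp_opp.
by move=> v _; rewrite subrr inner0l.
Qed.

Lemma PFB F x y : PF F (x - y) = PF F x - PF F y.
Proof. by rewrite !PFE mulmxBl. Qed.

Lemma oproj_orth F x : oproj (orth F) x = x - PF F x.
Proof.
apply: oproj_unique.
- by move=> u v Fu Fv y Fy; rewrite innerDl innerNl Fu// Fv// subrr.
- by move=> v Fv; rewrite PFE proj_mx_orth.
- by move=> v Fv; rewrite subKr innerC Fv//; exact: PF_sub.
Qed.

End InnerProduct.

(** * Determinants near the identity *)

Section Determinant.
Context {R : realFieldType} {n : nat}.

Lemma horner_char_poly (C : 'M[R]_n) s : (char_poly C).[s] = \det (s%:M - C).
Proof.
rewrite -horner_evalE -det_map_mx; congr (\det _); apply/matrixP => i j.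
by rewrite !mxE /= /horner_eval /= hornerD hornerN hornerMn hornerX hornerC.
Qed.

End Determinant.

(** With [C = I - A], the determinant is [t^n] times the characteristic polynomial of [C] at
    [1 / t], that is [1 + t (tr A - n) + O(t^2)]. *)
Lemma det_perturb_gt1 (R : realFieldType) n (A : 'M[R]_n) : n%:R < \tr A ->
  exists t : R, [/\ 0 < t, t < 1 & 1 < \det ((1 - t)%:M + t *: A)].
Proof.
case: n A => [|n] A trA; first by rewrite /mxtrace big_ord0 ltxx in trA.
pose C := 1%:M - A.
pose tau := - \tr C.
have tau0 : 0 < tau by rewrite /tau /C linearB/= mxtrace1 opprB subr_gt0.
pose chi := char_poly C.
pose M := \sum_(i < n) `|chi`_i|.
have M0 : 0 <= M by apply: sumr_ge0.
have [t [t0 t1 Mt]] : exists t : R, [/\ 0 < t, t < 1 & M * t < tau].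
  have den0 : 0 < tau + M + 1 by lra.
  (* This denominator secures both [t < 1] and [M * t < tau]. *)
  exists (tau / (tau + M + 1)); split; first by rewrite divr_gt0.
    by rewrite ltr_pdivrMr// mul1r; lra.
  by rewrite mulrA ltr_pdivrMr// mulrC ltr_pM2l//; lra.
exists t; split => //.
have -> : (1 - t)%:M + t *: A = t *: (t^-1%:M - C).
  rewrite scalerBr scale_scalar_mx divff ?gt_eqF// /C scalerBr opprB addrA.
  by rewrite scalemx1 raddfB/= addrAC.
rewrite detZ -horner_char_poly horner_coef size_char_poly -/chi !big_ord_recr/=.
have -> : chi`_n.+1 = 1.
  by have /monicP := char_poly_monic C; rewrite lead_coefE size_char_poly.
have -> : chi`_n = tau by rewrite /chi (@char_poly_trace _ n.+1 C).
rewrite !mulrDr mul1r -exprMn divff ?gt_eqF// expr1n.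
rewrite {2}exprS mulrCA -!mulrA -exprMn divff ?gt_eqF// expr1n mulr1.
(* The coefficient of index [i < n] comes with [t^(n + 1 - i)], at most [t^2] because
   [0 < t < 1]. *)
have : `|t ^+ n.+1 * \sum_(i < n) chi`_i * t^-1 ^+ i| <= M * t ^+ 2.
  rewrite mulr_sumr mulr_suml; apply: le_trans (ler_norm_sum _ _ _) _.
  apply: ler_sum => i _; rewrite mulrCA normrM ler_wpM2l//.
  have iE : (n.+1 = i + (n.+1 - i))%N by rewrite subnKC// ltnW// ltnS ltnW.
  rewrite {1}iE exprD mulrAC -exprMn divff ?gt_eqF// expr1n mul1r.
  rewrite normrX ger0_norm; last exact: ltW.
  rewrite ler_wiXn2l//; [exact: ltW|exact: ltW|].
  by rewrite ltn_subRL addn1 ltnS.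
rewrite ler_norml => /andP[lo _].
have : 0 < t * (tau - M * t) by rewrite mulr_gt0// subr_gt0.
by move: lo; rewrite expr2; lra.
Qed.

(** * Separation of translates *)

Section Continuity.
Context {R : realType}.

(** Entries range over any topological space because rows of vectors occur as well as rows of
    reals. *)
Lemma entry_continuous (T : topologicalType) m n i j :
  continuous (fun M : 'M[T]_(m, n) => M i j).
Proof.
move=> M A /= MA; exists (fun i' j' => [set x | i' = i -> j' = j -> A x]).
  move=> i' j'; have [[-> ->]|ne] := pselect (i' = i /\ j' = j).
    by apply: filterS MA => x Ax _ _.
  by apply: nearW => x /= ii jj; case: ne.
by move=> N /(_ i j) /=; exact.
Qed.

Lemma continuous_bigsum (T : topologicalType) (W : normedModType R) (I : Type)
    (r : seq I) (f : I -> T -> W) :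
  (forall i, continuous (f i)) -> continuous (fun x => \sum_(i <- r) f i x).
Proof.
move=> cf; elim: r => [|i r IH].
  rewrite (_ : (fun _ => _) = cst 0); first exact: cst_continuous.
  by apply/funext => x; rewrite big_nil.
rewrite (_ : (fun _ => _) = f i \+ (fun x => \sum_(j <- r) f j x)).
  by move=> x; apply: cvgD; [exact: cf|exact: IH].
by apply/funext => x; rewrite big_cons.
Qed.

Lemma continuous_scale (T : topologicalType) (W : normedModType R) (a : R) (f : T -> W) :
  continuous f -> continuous (fun x => a *: f x).
Proof. by move=> cf x; apply: cvgZ (cvg_cst a) (cf x). Qed.

Lemma mulmx_continuous d (A : 'M[R]_d) : continuous (fun x : 'rV[R]_d => x *m A).
Proof.
rewrite (_ : mulmx^~ A = fun x : 'rV[R]_d => \sum_(i < d) x 0 i *: row i A); last first.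
  by apply/funext => x; rewrite mulmx_sum_row.
apply: continuous_bigsum => i x.
exact: cvgZ (@entry_continuous R 1 d 0 i x) (cvg_cst _).
Qed.

Lemma sqnorm_continuous (T : topologicalType) d (f : T -> 'rV[R]_d) :
  continuous f -> continuous (fun x => inner (f x) (f x)).
Proof.
move=> cf; apply: continuous_bigsum => i x.
have c1 : {for x, continuous (fun y => f y 0 i)}.
  exact: (continuous_comp (cf x) (@entry_continuous R 1 d 0 i (f x))).
exact: (cvgM c1 c1).
Qed.

End Continuity.

Section Convexity.
Context {R : realType} {d : nat}.
Notation V := 'rV[R]_d.
Implicit Types (K X Y : set V) (F : 'M[R]_d).

Lemma convex_setE K (x y : V) (t : R) :
  convex_set (K : set (convex_lmodType V)) -> K x -> K y ->
  0 <= t -> t <= 1 -> K ((1 - t) *: x + t *: y).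
Proof.
move=> cK Kx Ky t0 t1; rewrite addrC.
exact: set_mem (cK y x (Itv01 t0 t1) (mem_set Ky) (mem_set Kx)).
Qed.

(** The combination is left unnormalised so that the induction can pass through total weight zero,
    where the point 0 of [K] serves. *)
Lemma convex_cone_sum K n (w : 'I_n -> R) (y : 'I_n -> V) :
  convex_set (K : set (convex_lmodType V)) -> K 0 ->
  (forall i, 0 <= w i) -> (forall i, K (y i)) ->
  exists2 s, K s & \sum_i w i *: y i = (\sum_i w i) *: s.
Proof.
move=> cK K0; elim: n w y => [|n IH] w y w0 Ky.
  by exists 0 => //; rewrite !big_ord0 scaler0.
have [s Ks ws] := IH (fun i => w (widen_ord (leqnSn n) i))
  (fun i => y (widen_ord (leqnSn n) i)) (fun i => w0 _) (fun i => Ky _).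
rewrite !big_ord_recr/= ws.
set W := \sum_(i < n) _; set v := w ord_max.
have W0 : 0 <= W by apply: sumr_ge0.
have v0 : 0 <= v by exact: w0.
have [Wv0|Wv0] := eqVneq (W + v) 0.
  have [-> ->] : W = 0 /\ v = 0 by split; lra.
  by exists 0 => //; rewrite !scale0r addr0 scaler0.
have Wvp : 0 < W + v by rewrite lt_neqAle eq_sym Wv0 addr_ge0.
exists ((1 - v / (W + v)) *: s + (v / (W + v)) *: y ord_max).
  apply: convex_setE => //; first by rewrite divr_ge0// ltW.
  by rewrite ler_pdivrMr// mul1r lerDr.
rewrite scalerDr !scalerA mulrBr mulr1 mulrCA divff// mulr1.
by rewrite addrK.
Qed.

(* At the configuration minimising the total squared deviation of the points x i + q i from
   their mean, the deviations f i certify that the sets X + q i have no common point. *)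
Lemma finite_translates_alternative X m (q : 'I_m.+1 -> V) :
  compact X -> convex_set (X : set (convex_lmodType V)) -> X !=set0 ->
  (exists w, forall i, X (w - q i)) \/
  exists x f : 'I_m.+1 -> V,
    [/\ forall i, X (x i),
        forall i, f i = m.+1%:R^-1 *: (\sum_j (x j + q j)) - (x i + q i),
        \sum_i f i = 0,
        forall i z, X z -> inner (f i) z <= inner (f i) (x i)
      & \sum_i inner (f i) (x i + q i) < 0].
Proof.
move=> Xc Xconv [x0 Xx0].
pose N : R := m.+1%:R.
have N0 : N != 0 by rewrite pnatr_eq0.
pose A := [set v : 'rV[V]_m.+1 | forall i, X (v ord0 i)].
have Ac : compact A by exact: (@rV_compact _ _ (fun=> X)).
have A0 : A !=set0 by exists (\row_i x0) => i; rewrite mxE.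
pose mean (v : 'rV[V]_m.+1) := N^-1 *: (\sum_j (v 0 j + q j)).
pose dev v i := mean v - (v 0 i + q i).
pose g v := \sum_i inner (dev v i) (dev v i).
have pc i : continuous (fun v : 'rV[V]_m.+1 => v 0 i + q i).
  by move=> v; exact: (cvgD (@entry_continuous V 1 m.+1 0 i v) (cvg_cst _)).
have meanc : continuous mean.
  by apply: continuous_scale; apply: continuous_bigsum.
have devc i : continuous (dev^~ i).
  by move=> v; exact: (cvgB (meanc v) (pc i v)).
have gc : continuous g.
  by apply: continuous_bigsum => i; exact: sqnorm_continuous.
have [v Av vmin] := compact_EVT_min A0 Ac (continuous_subspaceT gc).
have {}Av := set_mem Av.
pose x i := v 0 i.
have [f fE] : exists f, forall i, f i = dev v i by exists (dev v).
have sumf : \sum_i f i = 0.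
  rewrite (eq_bigr _ (fun i _ => fE i)) /dev sumrB sumr_const card_ord -scaler_nat.
  rewrite -/N /mean scalerA divff//.
  by rewrite scale1r subrr.
(* If all deviations vanish, every [x i + q i] equals the mean, which is then a common point. *)
have [g0|gn0] := eqVneq (g v) 0.
  left; exists (mean v) => i.
  have fi0 : dev v i = 0.
    apply: inner_eq0; apply/eqP; have /eqP := g0.
    rewrite psumr_eq0; last by move=> j _; exact: inner_ge0.
    by move=> /allP /(_ i (mem_index_enum i)).
  by move/eqP: fi0; rewrite subr_eq0 => /eqP ->; rewrite addrK.
right; exists x, f; split => // [i z Xz|]; last first.
  (* The [f i] sum to zero, so their pairing with the mean cancels and only minus their squared
     norms remain. *)
  have -> : \sum_i inner (f i) (x i + q i) = - g v.
    have -> : \sum_i inner (f i) (x i + q i) = \sum_i (inner (f i) (mean v) - inner (f i) (f i)).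
      by apply: eq_bigr => i _; rewrite -innerNr -innerDr {3}fE /dev subKr.
    rewrite sumrB -inner_suml sumf inner0l sub0r; congr (- _).
    by apply: eq_bigr => i _; rewrite fE.
  by rewrite oppr_lt0 lt_neqAle eq_sym gn0 sumr_ge0// => i _; exact: inner_ge0.
have [h hE] : exists h, h = z - x i by exists (z - x i).
have [e eE] : exists e : 'I_m.+1 -> V, forall j, e j = N^-1 *: h - (if j == i then h else 0).
  by exists (fun j => N^-1 *: h - (if j == i then h else 0)).
pose C := \sum_j inner (e j) (e j).
have C0 : 0 <= C by apply: sumr_ge0 => j _; exact: inner_ge0.
(* Moving [x i] towards [z] by [t] changes the deviation [j] by [t *: e j]. Minimality of [g] gives
   a quadratic inequality in [t], whose linear term reduces to [f i] because the [f j] sum to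
   zero. *)
have step t : 0 <= t -> t <= 1 -> 2 * t * inner (f i) h <= t ^+ 2 * C.
  move=> t0 t1.
  pose v' : 'rV[V]_m.+1 := \row_j (if j == i then (1 - t) *: x i + t *: z else v 0 j).
  have v'E j : v' 0 j + q j = v 0 j + q j + (if j == i then t *: h else 0).
    rewrite mxE addrAC; congr (_ + _); case: eqP => [->|_]; last by rewrite addr0.
    by rewrite hE scalerBl scale1r scalerBr -/(x i) addrA addrAC.
  have dev'E j : dev v' j = f j + t *: e j.
    rewrite /dev /mean v'E (eq_bigr _ (fun k _ => v'E k)) big_split/= -big_mkcond big_pred1_eq.
    rewrite scalerDr fE /dev /mean eE (scalerBr t) (scalerA N^-1) (scalerA t).
    rewrite (mulrC t) opprD addrACA; congr (_ + (_ - _)).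
    by case: ifP; rewrite ?scaler0.
  have : g v <= g v'.
    apply/vmin/mem_set => j; rewrite mxE; case: ifP => _; last exact: Av.
    exact: convex_setE.
  have -> : g v' = g v + 2 * t * \sum_j inner (f j) (e j) + t ^+ 2 * C.
    rewrite /g !mulr_sumr -!big_split/=; apply: eq_bigr => j _.
    by rewrite dev'E -!fE !(innerDl, innerDr, innerZl, innerZr) (innerC (e j) (f j)); ring.
  have -> : \sum_j inner (f j) (e j) = - inner (f i) h.
    under eq_bigr do rewrite eE innerDr innerNr innerZr.
    rewrite sumrB -mulr_sumr -inner_suml sumf inner0l mulr0 sub0r; congr (- _).
    rewrite (bigD1 i)//= eqxx big1 ?addr0// => j /negPf ->.
    by rewrite innerC inner0l.
  lra.
have fh : inner (f i) h <= 0.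
  rewrite leNgt; apply/negP => fh0.
  have D0 : 0 < inner (f i) h + C by lra.
  (* With [p = inner (f i) h > 0], such a [t] turns [step] into [2 t p <= t^2 C <= t p], which is
     absurd. *)
  have [t [t0 t1 tC]] : exists t : R, [/\ 0 < t, t <= 1 & t * C <= inner (f i) h].
    exists (inner (f i) h / (inner (f i) h + C)); split; first by rewrite divr_gt0.
      by rewrite ler_pdivrMr// mul1r; lra.
    by rewrite mulrAC ler_pdivrMr// ler_pM2l//; lra.
  have := step t (ltW t0) t1.
  have : t * (t * C) <= t * inner (f i) h by rewrite ler_wpM2l// ltW.
  have : 0 < t * inner (f i) h by rewrite mulr_gt0.
  by rewrite expr2; lra.
by move: fh; rewrite hE innerDr innerNr subr_le0.
Qed.

Lemma closed_subr_preimage X (u : V) : closed X -> closed [set w | X (w - u)].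
Proof.
move=> Xcl; apply: (@preimage_closed _ _ (fun w : V => w - u) X) => // w _.
exact: (cvgB cvg_id (cvg_cst _)).
Qed.

(** By compactness of [X], if all the translates have no common point then finitely many already
    have none, and the finite alternative yields the vectors. *)
Lemma translate_alternative X Y (c : R) :
  compact X -> convex_set (X : set (convex_lmodType V)) -> X !=set0 -> Y 0 ->
  (exists w, forall y, Y y -> X (w - c *: y)) \/
  exists m (y x f : 'I_m.+1 -> V),
    [/\ forall i, Y (y i) /\ X (x i),
        forall i, f i = m.+1%:R^-1 *: (\sum_j (x j + c *: y j)) - (x i + c *: y i),
        \sum_i f i = 0,
        forall i z, X z -> inner (f i) z <= inner (f i) (x i)
      & \sum_i inner (f i) (x i + c *: y i) < 0].
Proof.
move=> Xc Xconv X0 Y0; apply: contrapT => /not_orP[notw notcert].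
have Xcl : closed X by apply: compact_closed => //; exact: norm_hausdorff.
have := Xc; rewrite compact_In0.
move=> /(_ V Y (fun y => X `&` [set w | X (w - c *: y)])) [].
- exists (fun y => [set w | X (w - c *: y)]) => // y _.
  exact: closed_subr_preimage.
(* Prepending 0 makes the family nonempty and forces the common point to lie in [X] itself. *)
- move=> D DY; pose s : seq V := 0 :: finmap.enum_fset D.
  have sY i : Y s`_i.
    case: i => [//|i]; rewrite /s/=.
    have [iD|Di] := ltnP i (size (finmap.enum_fset D)); last by rewrite nth_default.
    exact: set_mem (DY _ (mem_nth 0 iD)).
  have [[w Xw]|[x [f [Xx fE f0 fx fneg]]]] :=
      @finite_translates_alternative X (size (finmap.enum_fset D)) (fun i => c *: s`_i) Xc Xconv X0.
    exists w => y /= yD; split.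
      by have := Xw ord0; rewrite /= scaler0 subr0.
    have /(nthP 0)[i iD <-] : y \in finmap.enum_fset D by [].
    by have := Xw (lift ord0 (Ordinal iD)).
  case: notcert; exists (size (finmap.enum_fset D)), (fun i => s`_i), x, f; split => // i.
- by move=> w Xw; apply: notw; exists w => y /Xw [].
Qed.

End Convexity.

(** * Optimality *)

Section Optimality.
Context {R : realType}.

Lemma vol_gt0 d (K : set 'rV[R]_d) : interior K 0 -> (0 < vol K)%E.
Proof.
move=> /nbhs_ballP[r /= r0 rK].
(* Balls of rows are open cubes, so half the radius leaves room for a closed box. *)
have r2 : 0 < r / 2 by rewrite divr_gt0.
apply: lt_le_trans (vol_cube_ge r2 _); first by rewrite lte_fin exprn_gt0// mulr_gt0.
move=> x xr; apply: rK; split => // i j; rewrite ord1.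
have := xr j; rewrite !mxE /ball/= sub0r normrN => xj.
by rewrite ltr_norml; apply/andP; split; lra.
Qed.

Lemma vol_compact_lt_pinfty n (K : set 'rV[R]_n.+1) : compact K -> (vol K < +oo)%E.
Proof.
move=> /compact_bounded[M [_ KM]].
have M1 : M < M + 1 by rewrite ltrDl.
apply: le_lt_trans (ltry (boxvol (const_mx (- (M + 1))) (const_mx (M + 1)))).
apply: le_trans (vol_box_le _ _); apply: le_vol => x /(KM _ M1) xM i.
rewrite !mxE -ler_norml; apply: le_trans xM.
rewrite [leRHS]/Num.norm/= mx_normrE.
exact: (le_bigmax 0 (fun ij : 'I_1 * 'I_n.+1 => `|x ij.1 ij.2|) (0, i)).
Qed.

(* First-order optimality of the identity: moving towards x |-> x *m A + z inside the convex
   set of admissible maps would increase the determinant if the trace exceeded the dimension. *)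
Lemma largest_trace_le n (K L : set 'rV[R]_n.+1) (F A : 'M[R]_n.+1) (z : 'rV[R]_n.+1) :
  compact K -> interior K 0 -> convex_set (L : set (convex_lmodType 'rV[R]_n.+1)) ->
  largest_in F K L ->
  (forall x, subsp F x -> subsp F (x *m A)) -> (forall x, orth F x -> x *m A = 0) ->
  (forall x, K x -> L (x *m A + z)) -> \tr A <= n.+1%:R.
Proof.
move=> Kc K0 Lconv [KL largest] FA AF KA; rewrite leNgt; apply/negP.
move=> /det_perturb_gt1[t [t0 t1 detB]].
set B := _ + _ in detB.
have Bunit : B \in unitmx by rewrite unitmxE unitfE gt_eqF// (lt_trans ltr01).
have BE x : x *m B = (1 - t) *: x + t *: (x *m A).
  by rewrite mulmxDr mul_mx_scalar -scalemxAr.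
pose M := [set x *m B + t *: z | x in K].
have ML : M `<=` L.
  move=> _ [x Kx <-]; rewrite BE -addrA -scalerDr.
  by apply: convex_setE => //; [exact: KL|exact: KA|exact: ltW|exact: ltW].
have MF : A_F F K M.
  exists B, (t *: z); split => //; split => //; split; [|split].
  - by move=> x Fx; rewrite BE; apply: subsp_add; apply: subsp_scale => //; exact: FA.
  - move=> x Ox v Fv; rewrite BE AF// scaler0 addr0 innerZl Ox// mulr0//.
  (* On the orthogonal of [F] the map [B] is multiplication by [1 - t], nonzero because [t < 1]. *)
  - exists (1 - t); split; first by rewrite subr_eq0 gt_eqF.
    by move=> x Ox; rewrite BE AF// scaler0 addr0.
have := largest M MF ML; apply/negP; rewrite -ltNge.
have volK : vol K \is a fin_num by rewrite ge0_fin_numE ?vol_ge0// vol_compact_lt_pinfty.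
(* Volumes of images are bounded from above only, so [K] is written as an image of [M]; this gives
   [vol K <= vol M / det B], hence [vol K < vol M]. *)
have KM : K = [set y *m invmx B | y in [set (m + - (t *: z))%R | m in M]].
  apply/seteqP; split => [x Kx|_ [_ [_ [x Kx <-] <-] <-]].
    exists (x *m B); last by rewrite mulmxK.
    by exists (x *m B + t *: z); [exists x|rewrite addrK].
  by rewrite addrK mulmxK.
have Binv : invmx B \in unitmx by rewrite unitmx_inv.
have det_gt0 : 0 < \det B by apply: lt_trans detB.
have : (vol K <= (\det B)^-1%:E * vol M)%E.
  rewrite {1}KM; apply: (le_trans (vol_mulmx_le _ Binv)).
  have inv_ge0 : 0 <= (\det B)^-1 by rewrite invr_ge0 ltW.
  by rewrite det_inv ger0_norm//; apply: lee_wpmul2l => //; exact: vol_translate_le.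
rewrite lee_pdivlMl//; apply: lt_le_trans.
rewrite -(fineK volK) -EFinM lte_fin ltr_pMl// fine_gt0//.
by rewrite vol_gt0//= vol_compact_lt_pinfty.
Qed.

End Optimality.

(** * Construction of the center *)

Section Center.
Context {R : realType} {n : nat}.
Notation V := 'rV[R]_n.+1.
Implicit Types (K L : set V) (F : 'M[R]_n.+1).

Lemma PF_image_compact K F : compact K -> compact (PF F @` K).
Proof.
move=> Kc; rewrite (_ : PF F = mulmx^~ (proj_mx F)); last first.
  by apply/funext => x; rewrite PFE.
by apply: continuous_compact => //; apply: continuous_subspaceT; exact: mulmx_continuous.
Qed.

Lemma PF_image_convex K F : convex_set (K : set (convex_lmodType V)) ->
  convex_set (PF F @` K : set (convex_lmodType V)).
Proof.
move=> cK x y l /set_mem[x' Kx' <-] /set_mem[y' Ky' <-]; apply: mem_set.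
exists (l%:inum *: x' + (1 - l%:inum) *: y').
  exact: set_mem (cK x' y' l (mem_set Kx') (mem_set Ky')).
by rewrite !PFE mulmxDl -!scalemxAl.
Qed.

Lemma exists_projection_anchor K L F :
  convex_body K -> convex_body L -> interior K 0 -> interior L 0 ->
  largest_in F K L ->
  exists w, forall y, (L `&` subsp F) y -> (PF F @` K) (w - n.+1%:R^-1 *: y).
Proof.
move=> [Kc [Kconv _]] [_ [Lconv _]] K0 L0 largest.
set X := PF F @` K; set Y := L `&` subsp F.
have PF0 : PF F 0 = 0 by rewrite PFE mul0mx.
have X0 : X 0 by exists 0 => //; exact: interior_subset K0.
have Y0 : Y 0 by split; [exact: interior_subset L0|exact: sub0mx].
have XF x : X x -> subsp F x by move=> [x' _ <-]; exact: PF_sub.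
set D : R := n.+1%:R.
have D0 : 0 < D by rewrite ltr0n.
have [//|[m [y [x [f [XY fE sumf fmax fneg]]]]]] :=
  @translate_alternative _ _ X Y D^-1 (PF_image_compact (F := F) Kc)
    (PF_image_convex Kconv) (ex_intro _ 0 X0) Y0.
exfalso.
have Fy i : subsp F (y i) by have [[]] := XY i.
have Ly i : L (y i) by have [[]] := XY i.
have Xx i : X (x i) by have [] := XY i.
have Fp i : subsp F (x i + D^-1 *: y i).
  by apply: subsp_add; [exact: XF|exact: subsp_scale].
(* This makes [A] below vanish on the orthogonal of [F], and lets [f i] take the same values on [u]
   and on [PF F u]. *)
have Ff i : subsp F (f i).
  rewrite fE; apply: subsp_add; last exact: subsp_opp.
  by apply: subsp_scale; apply: summx_sub => j _; exact: Fp.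
pose S1 := \sum_i inner (f i) (x i).
pose S2 := \sum_i inner (f i) (y i).
have S12 : D * S1 < - S2.
  have : S1 + D^-1 * S2 < 0.
    rewrite /S1 /S2 mulr_sumr -big_split/=.
    by under eq_bigr do rewrite -innerZr -innerDr.
  by rewrite -(ltr_pM2l D0) mulr0 mulrDr mulrA divff ?gt_eqF// mul1r; lra.
have a0 i : 0 <= inner (f i) (x i) by rewrite -(inner0l (f i)) innerC; exact: fmax.
have [e [e0 eS]] : exists e : R, 0 < e /\ D * (S1 + m.+1%:R * e) < - S2.
  have c0 : 0 < D * m.+1%:R * 2 by rewrite !mulr_gt0// ltr0n.
  (* The slack spends half of the gap in [S12]; it makes [s] positive even if all the maxima are
     zero. *)
  exists ((- S2 - D * S1) / (D * m.+1%:R * 2)); split.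
    by rewrite divr_gt0// subr_gt0.
  have midpoint (u v k l : R) : u != 0 -> k != 0 ->
      u * (v + k * ((- l - u * v) / (u * k * 2))) = (u * v - l) / 2.
    by move=> u0 k0; field; rewrite k0.
  rewrite midpoint ?pnatr_eq0//; first by lra.
pose s := S1 + m.+1%:R * e.
have s0 : 0 < s.
  by rewrite ltr_wpDl ?sumr_ge0// mulr_gt0// ltr0n.
(* The affine map [u *m A + z] is the sum of the [(b i - inner (f i) u) / s *: y i]; its rank-one
   terms give trace [- S2 / s], which exceeds [D] by [eS]. *)
pose A : 'M[R]_n.+1 := \sum_i (- s^-1) *: ((f i)^T *m y i).
pose b i := inner (f i) (x i) + e.
pose z := \sum_i (b i / s) *: y i.
have AE u : u *m A = \sum_i (- (inner (f i) u / s)) *: y i.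
  rewrite /A mulmx_sumr; apply: eq_bigr => i _.
  rewrite -scalemxAr mulmxA [u *m _]mx11_scalar mul_scalar_mx scalerA -innerE innerC.
  by rewrite mulNr mulrC.
have trA : \tr A = - S2 / s.
  rewrite /A raddf_sum /S2 -sumrN mulr_suml; apply: eq_bigr => i _.
  rewrite /= mxtraceZ mxtrace_mulC trace_mx11 -innerE innerC.
  by rewrite mulNr mulrC -mulNr.
have : \tr A <= D.
  apply: (@largest_trace_le R n K L F A z) => //.
  - by move=> u Fu; rewrite AE; apply: summx_sub => i _; exact: subsp_scale.
  - move=> u Ou; rewrite AE big1// => i _.
    by rewrite innerC Ou// mul0r oppr0 scale0r.
  - move=> u Ku.
    have w0 i : 0 <= (b i - inner (f i) u) / s.
      apply: divr_ge0; last exact: ltW.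
      have : inner (f i) (PF F u) <= inner (f i) (x i) by apply: fmax; exists u.
      rewrite innerC inner_PF// innerC /b; lra.
    (* The dependence on [u] cancels because the [f i] sum to zero. *)
    have w1 : \sum_i ((b i - inner (f i) u) / s) = 1.
      rewrite -mulr_suml sumrB -inner_suml sumf inner0l subr0 /b big_split/=.
      by rewrite sumr_const card_ord -mulr_natl divff// gt_eqF.
    have [v Lv wv] := convex_cone_sum Lconv (interior_subset L0) w0 Ly.
    suff -> : u *m A + z = v by [].
    rewrite AE /z -big_split/= -[RHS]scale1r -w1 -wv.
    by apply: eq_bigr => i _; rewrite -scalerDl mulrBl addrC.
by rewrite trA ler_pdivrMr// leNgt -/s eS.
Qed.

(** With [z = D / (D + 1) w], a point [y - z] of the translated section is [- D (x - z)] for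
    [x = w - y / D], which lies in the projection of [K]. *)
Lemma good_center_of_projection K L F :
  convex_body K -> convex_body L -> interior K 0 -> interior L 0 ->
  largest_in F K L -> PF F @` K `<=` L `&` subsp F -> good_center F K L.
Proof.
move=> Kb Lb K0 L0 largest PKL.
have [w wK] := exists_projection_anchor Kb Lb K0 L0 largest.
have [_ [Kconv _]] := Kb.
have Xconv := PF_image_convex (F := F) Kconv.
set D : R := n.+1%:R in wK *.
have D0 : 0 < D by rewrite ltr0n.
have Y0 : (L `&` subsp F) 0 by split; [exact: interior_subset L0|exact: sub0mx].
have Xw : (PF F @` K) w by have := wK _ Y0; rewrite scaler0 subr0.
have Fw : subsp F w by case: Xw => x _ <-; exact: PF_sub.
have D1 : D + 1 != 0 by rewrite gt_eqF// addr_gt0.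
pose z := (D / (D + 1)) *: w.
have Fz : subsp F z by exact: subsp_scale.
(* A perturbation of [z] is absorbed by the point 0, which has weight [1 / (D + 1)] in [z] and a
   ball of [F] around it inside the projection. *)
have zE h : z + h = (1 - (D + 1)^-1) *: w + (D + 1)^-1 *: ((D + 1) *: h).
  rewrite scalerA mulVf// scale1r; congr (_ *: _ + _).
  by field.
have [r r0 rK] : exists2 r : R, 0 < r & forall h, subsp F h -> ball (0 : V) r h -> (PF F @` K) h.
  have /nbhs_ballP[r /= r0 rK] := K0; exists r => // h Fh /rK Kh.
  by exists h => //; exact: PF_id.
have Dinv0 : 0 <= (D + 1)^-1 by rewrite invr_ge0 ltW// addr_gt0.
have Dinv1 : (D + 1)^-1 <= 1 by rewrite invf_le1 ?addr_gt0// lerDr ltW.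
have near_z h : subsp F h -> ball (0 : V) r ((D + 1) *: h) -> (PF F @` K) (z + h).
  by move=> Fh hr; rewrite zE; apply: convex_setE => //; apply: rK => //; exact: subsp_scale.
exists z; split.
  split.
    rewrite -[z]addr0; apply: near_z; first exact: sub0mx.
    by rewrite scaler0; exact: ballxx.
  exists (r / (D + 1)); split; first by rewrite divr_gt0// addr_gt0.
  move=> x [zx affx].
  (* The affine hull of the projection is contained in [F], since [F] is itself affine. *)
  have Fx : subsp F x.
    apply: (affx (subsp F)); split; last by move=> _ [u _ <-]; exact: PF_sub.
    by move=> u v t Fu Fv; apply: subsp_add; exact: subsp_scale.
  rewrite -[x](subrKC z); apply: near_z.
    by apply: subsp_add => //; exact: subsp_opp.
  move: zx; rewrite -!ball_normE /ball_/= sub0r normrN normrZ distrC.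
  by rewrite ltr_pdivlMr ?addr_gt0// mulrC ger0_norm// ltW// addr_gt0.
have PFz : PF F z = z by exact: PF_id.
split=> [_ [x Kx <-]|_ [[y Ly <-] Fyz]].
  have PKx : (PF F @` K) (PF F x) by exists x.
  have [LPx FPx] := PKL _ PKx.
  split; last exact: PF_sub.
  by exists (PF F x) => //; rewrite PFB PFz.
have Fy : subsp F y by rewrite -[y](subrK z); exact: subsp_add.
have [x Kx PFx] := wK y (conj Ly Fy).
exists (PF F (x - z)); first by exists x.
have Dw : D *: w = (D + 1) *: z by rewrite /z scalerA mulrC divfK.
rewrite PFB PFz PFx !scalerBr !scaleNr scalerA divff ?gt_eqF// scale1r Dw !opprK.
by rewrite scalerDl scale1r opprD addrC !addrA subrr sub0r addrC.
Qed.

(** The projection of [x] is the midpoint of [x] and its reflection. *)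
Lemma PF_image_of_sym K F : convex_set (K : set (convex_lmodType V)) ->
  sym_wrt F K -> PF F @` K `<=` K.
Proof.
move=> Kconv Ksym _ [x Kx <-].
have h0 : 0 <= 2^-1 :> R by rewrite invr_ge0.
have h1 : 2^-1 <= 1 :> R by lra.
suff -> : PF F x = (1 - 2^-1) *: x + 2^-1 *: (PF F x - oproj (orth F) x).
  by apply: convex_setE => //; exact: Ksym.
by rewrite oproj_orth; apply/rowP => i; rewrite !mxE; lra.
Qed.

End Center.

(** Dimension 0 is treated apart because the volume estimates live in dimension [n.+1]; here every
    vector is 0. *)
Lemma good_center0 (R : realType) (K L : set 'rV[R]_0) (F : 'M[R]_0) :
  K 0 -> L 0 -> good_center F K L.
Proof.
move=> K0 L0.
have PK0 : (PF F @` K) 0 by exists 0 => //; rewrite [LHS]thinmx0.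
exists 0; split.
  by split => //; exists 1; split => // x _; rewrite [x]thinmx0.
split=> [y _|y _]; rewrite [y]thinmx0.
  by split; [exists 0 => //; rewrite subr0|exact: sub0mx].
by exists (PF F (0 - 0)); [exists 0|rewrite [LHS]thinmx0].
Qed.
Unset Implicit Arguments.

Theorem mainTheorem2 (R : realType) (d : nat) (K L : set 'rV[R]_d) (F : 'M[R]_d) :
  convex_body K -> convex_body L ->
  interior K 0 -> interior L 0 ->
  K `<=` L ->
  largest_in F K L ->
  ((PF F @` K `<=` L `&` subsp F -> good_center F K L) /\
   (sym_wrt F K -> good_center F K L)).
Proof.
case: d K L F => [|n] K L F Kb Lb K0 L0 KL largest.
  by split=> _; apply: good_center0; exact: interior_subset.
split=> [PKL|Ksym]; first exact: good_center_of_projection.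
apply: good_center_of_projection => // u PKu; split.
  by apply/KL/(PF_image_of_sym _ Ksym PKu); case: Kb => _ [].
by case: PKu => x _ <-; exact: PF_sub.
Qed.
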